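(* Every normal nearly Kenmotsu manifold is a Kenmotsu manifold.
   Context: All objects are smooth ($C^\infty$) and manifolds are connected. An almost contact metric structure on a $(2n+1)$-dimensional manifold $M$ is a quadruple $(\phi,\xi,\eta,g)$ consisting of a $(1,1)$-tensor field $\phi$, a vector field $\xi$, a one-form $\eta$ and a Riemannian metric $g$ such that $\phi^2=-\mathrm{Id}+\eta\otimes\xi$, $\eta(\xi)=1$ and $g(\phi X,\phi Y)=g(X,Y)-\eta(X)\eta(Y)$ for all vector fields $X,Y$; then $\eta(X)=g(X,\xi)$, $\phi\xi=0$, $\eta\circ\phi=0$ and $g(X,\phi Y)+g(\phi X,Y)=0$. Let $\nabla$ be the Levi-Civita connection of $g$. The almost contact metric manifold $(M,\phi,\xi,\eta,g)$ is called: - nearly Kenmotsu if $(\nabla_X\phi)Y+(\nabla_Y\phi)X=-\eta(Y)\phi X-\eta(X)\phi Y$ for all vector fields $X,Y$; - Kenmotsu if $(\nabla_X\phi)Y=g(\phi X,Y)\xi-\eta(Y)\phi X$ for all vector fields $X,Y$; - normal if $[\phi,\phi]+2\,d\eta\otimes\xi=0$, where $[\phi,\phi](X,Y)=\phi^2[X,Y]+[\phi X,\phi Y]-\phi[\phi X,Y]-\phi[X,\phi Y]$ is the Nijenhuis torsion of $\phi$ and $d\eta(X,Y)=\tfrac12\bigl(X\eta(Y)-Y\eta(X)-\eta([X,Y])\bigr)$. *)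

(* Defs.v *)
From HB Require Import structures.
From mathcomp Require Import all_boot all_order all_algebra.
From mathcomp Require Import all_classical all_reals all_analysis.
From mathcomp Require Import ring.

Set Implicit Arguments.
Unset Strict Implicit.
Unset Printing Implicit Defensive.

Import Order.TTheory GRing.Theory Num.Theory.
Import numFieldNormedType.Exports.
Local Open Scope classical_set_scope.
Local Open Scope ring_scope.

(** C^k maps on an open subset of R^m, by iterated partial derivatives. The
    derivatives are taken in the whole space, so these notions are only
    meaningful for an open [U]. *)

Fixpoint Ck_on (R : realType) (m : nat) (V : normedModType R) (k : nat)
    (U : set 'rV[R]_m) (f : 'rV[R]_m -> V) : Prop :=
  (forall x, U x -> {for x, continuous f}) /\
  (if k is k'.+1 then
     forall i : 'I_m, (forall x, U x -> derivable f x (delta_mx 0 i)) /\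
                      Ck_on k' U ('D_(delta_mx 0 i) f)
   else True).

Definition smooth_on (R : realType) (m : nat) (V : normedModType R)
    (U : set 'rV[R]_m) (f : 'rV[R]_m -> V) : Prop :=
  forall k, Ck_on k U f.

Section CkTheory.
Variables (R : realType) (m : nat).
Implicit Types (U : set 'rV[R]_m) (f g : 'rV[R]_m -> R^o).

Lemma Ck_on_eq k U f g : open U -> (forall x, U x -> f x = g x) ->
  Ck_on k U f -> Ck_on k U g.
Proof.
move=> oU; elim: k f g => [|k IH] f g fg /= [cf df].
  split=> // x Ux.
  have nfg : \forall y \near x, f y = g y by apply: filterS (open_nbhs_nbhs (conj oU Ux)); exact: fg.
  rewrite /prop_for /continuous_at -(fg x Ux).
  exact: cvg_trans (near_eq_cvg nfg) (cf x Ux).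
have nfg x : U x -> \forall y \near x, f y = g y.
  by move=> Ux; apply: filterS (open_nbhs_nbhs (conj oU Ux)); exact: fg.
split=> [x Ux|i].
  rewrite /prop_for /continuous_at -(fg x Ux).
  exact: cvg_trans (near_eq_cvg (nfg x Ux)) (cf x Ux).
have [dfi dfC] := df i; split=> [x Ux|].
  by have [] := near_eq_is_derive (nfg x Ux) (derivableP (dfi x Ux)).
by apply: IH dfC => x Ux; exact: near_eq_derive (nfg x Ux).
Qed.

Lemma Ck_onW k U f : Ck_on k.+1 U f -> Ck_on k U f.
Proof.
elim: k f => [|k IH] f [cf df]; first by split.
by split=> // i; have [di Ci] := df i; split=> //; exact: IH.
Qed.

Lemma Ck_on_cst k U (c : R) : Ck_on k U (cst c : _ -> R^o).
Proof.
have cc (c' : R) x : U x -> {for x, continuous (cst c' : 'rV[R]_m -> R^o)}.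
  by move=> _; exact: cst_continuous.
elim: k c => [|k IH] c; first by split=> // x; exact: cc.
split=> [x|i]; first exact: cc.
split=> [x _|]; first exact: derivable_cst.
rewrite (_ : 'D_(delta_mx 0 i) _ = cst 0); first exact: IH.
by apply/funext => x; exact: derive_cst.
Qed.

Lemma Ck_onD k U f g : open U -> Ck_on k U f -> Ck_on k U g ->
  Ck_on k U (f + g).
Proof.
move=> oU; elim: k f g => [|k IH] f g [cf df] [cg dg] /=.
  by split=> // x Ux; apply: continuousD; [exact: cf|exact: cg].
split=> [x Ux|i]; first by apply: continuousD; [exact: cf|exact: cg].
have [dfi Cf] := df i; have [dgi Cg] := dg i; split=> [x Ux|].
  by apply: derivableD; [exact: dfi|exact: dgi].
apply: (Ck_on_eq oU _ (IH _ _ Cf Cg)) => x Ux.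
by rewrite deriveD; [|exact: dfi|exact: dgi].
Qed.

Lemma Ck_onM k U f g : open U -> Ck_on k U f -> Ck_on k U g ->
  Ck_on k U (f * g).
Proof.
move=> oU; elim: k f g => [|k IH] f g Cf0 Cg0.
  have [cf _] := Cf0; have [cg _] := Cg0.
  by split=> // x Ux; apply: continuousM; [exact: cf|exact: cg].
have [cf df] := Cf0; have [cg dg] := Cg0.
split=> [x Ux|i]; first by apply: continuousM; [exact: cf|exact: cg].
have [dfi Cf] := df i; have [dgi Cg] := dg i; split=> [x Ux|].
  by apply: derivableM; [exact: dfi|exact: dgi].
apply: (Ck_on_eq oU _ (Ck_onD oU (IH _ _ (Ck_onW Cf0) Cg)
                                 (IH _ _ (Ck_onW Cg0) Cf))) => x Ux.
by rewrite deriveM; [|exact: dfi|exact: dgi].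
Qed.

End CkTheory.

Record chart (R : realType) (m : nat) (M : topologicalType) := Chart {
  chart_dom : set M;
  chart_map :> M -> 'rV[R]_m;
  (* the inverse chart; irrelevant outside the image of [chart_dom] *)
  chart_inv : 'rV[R]_m -> M;
  chart_dom_open : open chart_dom;
  chart_img_open : open (chart_map @` chart_dom);
  chart_mapK : forall p, chart_dom p -> chart_inv (chart_map p) = p;
  chart_map_cont : forall p, chart_dom p -> {for p, continuous chart_map};
  chart_inv_cont : forall x, (chart_map @` chart_dom) x ->
    {for x, continuous chart_inv} }.

(* Only an atlas is recorded, not the maximal one: it determines the smooth
   structure. *)
Record manifold (R : realType) (m : nat) := Manifold {
  manifold_sort :> topologicalType;
  manifold_hausdorff : hausdorff_space manifold_sort;
  manifold_second_countable : @second_countable manifold_sort;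
  manifold_connected : connected [set: manifold_sort];
  atlas : set (chart R m manifold_sort);
  atlas_cover : forall p, exists2 c, atlas c & chart_dom c p;
  atlas_smooth : forall c d, atlas c -> atlas d ->
    smooth_on (c @` (chart_dom c `&` chart_dom d)) (d \o chart_inv c) }.

Definition smooth_fun (R : realType) (m : nat) (M : manifold R m)
    (f : M -> R) : Prop :=
  forall c, atlas c ->
    smooth_on (c @` chart_dom c) (f \o chart_inv c : 'rV[R]_m -> R^o).

Definition smooth_pred (R : realType) (m : nat) (M : manifold R m) :
  {pred M -> R} := fun f => `[< smooth_fun f >].

Fact smooth_subring_closed (R : realType) (m : nat) (M : manifold R m) :
  subring_closed (@smooth_pred R m M).
Proof.
have N1 (h : M -> R) : h \in @smooth_pred R m M -> - h \in @smooth_pred R m M.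
  move=> /asboolP sh; apply/asboolP => c Ac k.
  have := Ck_onM (@chart_img_open _ _ _ c) (Ck_on_cst k _ (-1)) (sh c Ac k).
  congr (Ck_on _ _ _); apply/funext => x.
  by rewrite /GRing.mul/= mulN1r.
split.
- by apply/asboolP => c _ k; exact: Ck_on_cst.
- move=> f g /asboolP sf /N1/asboolP sg; apply/asboolP => c Ac k.
  exact (Ck_onD (@chart_img_open _ _ _ c) (sf c Ac k) (sg c Ac k)).
- move=> f g /asboolP sf /asboolP sg; apply/asboolP => c Ac k.
  exact (Ck_onM (@chart_img_open _ _ _ c) (sf c Ac k) (sg c Ac k)).
Qed.

Fact smooth_scaler_closed (R : realType) (m : nat) (M : manifold R m) :
  scaler_closed (@smooth_pred R m M).
Proof.
move=> a f /asboolP sf; apply/asboolP => c Ac k.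
exact (Ck_onM (@chart_img_open _ _ _ c) (Ck_on_cst k _ a) (sf c Ac k)).
Qed.

HB.instance Definition _ (R : realType) (m : nat) (M : manifold R m) :=
  GRing.isSubringClosed.Build (M -> R) (@smooth_pred R m M)
    (@smooth_subring_closed R m M).
HB.instance Definition _ (R : realType) (m : nat) (M : manifold R m) :=
  GRing.isScaleClosed.Build R (M -> R) (@smooth_pred R m M)
    (@smooth_scaler_closed R m M).

Record Cinf (R : realType) (m : nat) (M : manifold R m) := MkCinf {
  Cinf_fun :> M -> R;
  Cinf_smooth : Cinf_fun \in @smooth_pred R m M }.

Section CinfInstances.
Variables (R : realType) (m : nat) (M : manifold R m).
HB.instance Definition _ := [isSub for @Cinf_fun R m M].
HB.instance Definition _ := [Choice of Cinf M by <:].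
HB.instance Definition _ :=
  GRing.SubChoice_isSubComPzRing.Build (M -> R) (@smooth_pred R m M) (Cinf M)
    (@smooth_subring_closed R m M).
HB.instance Definition _ := [SubZmodule_isSubLmodule of Cinf M by <:].
End CinfInstances.

(** Tangent vectors at p are derivations at p of the globally defined smooth
    functions; as M is Hausdorff and second countable, bump functions make this
    the same as derivations of germs, and the global smoothness tests used
    below for sections and tensor fields the same as the local ones. *)

Definition derivation_at (R : realType) (m : nat) (M : manifold R m) (p : M)
    (v : Cinf M -> R) : Prop :=
  (forall (a : R) (f g : Cinf M), v (a *: f + g) = a * v f + v g) /\
  (forall f g : Cinf M, v (f * g) = v f * g p + f p * v g).

Definition derivation_pred (R : realType) (m : nat) (M : manifold R m) (p : M) :
  {pred Cinf M -> R} := fun v => `[< derivation_at p v >].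

Fact derivation_submod_closed (R : realType) (m : nat) (M : manifold R m)
  (p : M) : submod_closed (derivation_pred p).
Proof.
split=> [|a u v /asboolP[lu Lu] /asboolP[lv Lv]].
  by apply/asboolP; split=> [b f g|f g]; rewrite /GRing.zero /= ?mulr0 ?mul0r addr0.
apply/asboolP; split=> [b f g|f g].
  change (a * u (b *: f + g) + v (b *: f + g) =
          b * (a * u f + v f) + (a * u g + v g)).
  by rewrite lu lv !mulrDr addrACA mulrCA.
change (a * u (f * g) + v (f * g) =
        (a * u f + v f) * g p + f p * (a * u g + v g)).
by rewrite Lu Lv !mulrDr mulrDl addrACA mulrA (mulrCA a).
Qed.

HB.instance Definition _ (R : realType) (m : nat) (M : manifold R m) (p : M) :=
  GRing.isSubmodClosed.Build R (Cinf M -> R) (derivation_pred p)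
    (derivation_submod_closed p).

Record tangent (R : realType) (m : nat) (M : manifold R m) (p : M) :=
  MkTangent {
    tangent_fun :> Cinf M -> R;
    tangent_derivation : tangent_fun \in derivation_pred p }.

Section TangentInstances.
Variables (R : realType) (m : nat) (M : manifold R m) (p : M).
HB.instance Definition _ := [isSub for @tangent_fun R m M p].
HB.instance Definition _ := [Choice of tangent p by <:].
HB.instance Definition _ := [SubChoice_isSubLmodule of tangent p by <:].
End TangentInstances.

Definition smooth_section (R : realType) (m : nat) (M : manifold R m)
    (X : forall p : M, tangent p) : Prop :=
  forall f : Cinf M, smooth_fun (fun p => X p f).

Record vfield (R : realType) (m : nat) (M : manifold R m) := VField {
  vf_at :> forall p : M, tangent p;
  vf_smooth : smooth_section vf_at }.

Section VFieldInstances.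
Variables (R : realType) (m : nat) (M : manifold R m).
Implicit Types (X Y Z : vfield M) (f g : Cinf M).

HB.instance Definition _ := gen_eqMixin (vfield M).
HB.instance Definition _ := gen_choiceMixin (vfield M).

(* the function X f : p |-> X_p f *)
Definition vf_app X f : Cinf M :=
  MkCinf (introT (asboolP _) (@vf_smooth _ _ _ X f)).

Lemma vfieldP X Y : (forall p f, X p f = Y p f) -> X = Y.
Proof.
case: X Y => [X sX] [Y sY] /= XY.
have E : X = Y.
  apply: functional_extensionality_dep => p.
  by apply: val_inj; apply/funext => f; exact: XY.
by rewrite E in sX *; congr VField; exact: Prop_irrelevance.
Qed.

Fact vf_zero_smooth : smooth_section (fun p : M => 0 : tangent p).
Proof. by move=> f; apply/asboolP; exact: (rpred0 (@smooth_pred R m M)). Qed.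

Fact vf_opp_smooth X : smooth_section (fun p => - X p).
Proof.
by move=> f; apply/asboolP; exact: (rpredNr (Cinf_smooth (vf_app X f))).
Qed.

Fact vf_add_smooth X Y : smooth_section (fun p => X p + Y p).
Proof.
move=> f; apply/asboolP.
exact: (rpredD (Cinf_smooth (vf_app X f)) (Cinf_smooth (vf_app Y f))).
Qed.

Fact vf_scale_smooth g X : smooth_section (fun p => g p *: X p).
Proof.
move=> f; apply/asboolP.
exact: (rpredM (Cinf_smooth g) (Cinf_smooth (vf_app X f))).
Qed.

Definition vf_zero : vfield M := VField vf_zero_smooth.
Definition vf_opp X : vfield M := VField (vf_opp_smooth X).
Definition vf_add X Y : vfield M := VField (vf_add_smooth X Y).
Definition vf_scale g X : vfield M := VField (vf_scale_smooth g X).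

Fact vf_addA : associative vf_add.
Proof. by move=> X Y Z; apply: vfieldP => p f; exact: addrA. Qed.
Fact vf_addC : commutative vf_add.
Proof. by move=> X Y; apply: vfieldP => p f; exact: addrC. Qed.
Fact vf_add0 : left_id vf_zero vf_add.
Proof. by move=> X; apply: vfieldP => p f; exact: add0r. Qed.
Fact vf_addN : left_inverse vf_zero vf_opp vf_add.
Proof. by move=> X; apply: vfieldP => p f; exact: addNr. Qed.

HB.instance Definition _ :=
  GRing.isZmodule.Build (vfield M) vf_addA vf_addC vf_add0 vf_addN.

Fact vf_scaleA f g X : vf_scale f (vf_scale g X) = vf_scale (f * g) X.
Proof. by apply: vfieldP => p h; exact: mulrA. Qed.
Fact vf_scale1 : left_id 1 vf_scale.
Proof. by move=> X; apply: vfieldP => p h; exact: mul1r. Qed.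
Fact vf_scaleDr : right_distributive vf_scale +%R.
Proof. by move=> f X Y; apply: vfieldP => p h; exact: mulrDr. Qed.
Fact vf_scaleDl X : {morph vf_scale^~ X : f g / f + g}.
Proof. by move=> f g; apply: vfieldP => p h; exact: mulrDl. Qed.

HB.instance Definition _ := GRing.Zmodule_isLmodule.Build (Cinf M) (vfield M)
  vf_scaleA vf_scale1 vf_scaleDr vf_scaleDl.

Lemma vf_app_linear X (a : R) f g :
  vf_app X (a *: f + g) = a *: vf_app X f + vf_app X g.
Proof.
by apply/val_inj/funext => p; have /asboolP[lX _] := tangent_derivation (X p); exact: lX.
Qed.

Lemma vf_app_leibniz X f g :
  vf_app X (f * g) = vf_app X f * g + f * vf_app X g.
Proof.
by apply/val_inj/funext => p; have /asboolP[_ LX] := tangent_derivation (X p); exact: LX.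
Qed.

Fact lie_derivation X Y (p : M) :
  (fun f => X p (vf_app Y f) - Y p (vf_app X f)) \in derivation_pred p.
Proof.
have /asboolP[lX LX] := tangent_derivation (X p).
have /asboolP[lY LY] := tangent_derivation (Y p).
have DX (f g : Cinf M) : X p (f + g) = X p f + X p g.
  by rewrite -[f]scale1r lX mul1r scale1r.
have DY (f g : Cinf M) : Y p (f + g) = Y p f + Y p g.
  by rewrite -[f]scale1r lY mul1r scale1r.
apply/asboolP; split=> [a f g|f g].
  by rewrite !vf_app_linear lX lY mulrBr opprD addrACA.
rewrite !vf_app_leibniz DX DY !LX !LY /=.
ring.
Qed.

Fact lie_smooth X Y : smooth_section (fun p => MkTangent (lie_derivation X Y p)).
Proof.
move=> f; apply/asboolP.
exact: (rpredB (Cinf_smooth (vf_app X (vf_app Y f)))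
               (Cinf_smooth (vf_app Y (vf_app X f)))).
Qed.

(* [X, Y] f = X (Y f) - Y (X f) *)
Definition lie X Y : vfield M := VField (lie_smooth X Y).

End VFieldInstances.

(** A field of (multi)linear maps on the tangent spaces is smooth
    when it maps smooth vector fields to smooth objects. *)

Record endo_field (R : realType) (m : nat) (M : manifold R m) := EndoField {
  endo_at : forall p : M, {linear tangent p -> tangent p};
  endo_smooth : forall X : vfield M, smooth_section (fun p => endo_at p (X p)) }.

Record one_form (R : realType) (m : nat) (M : manifold R m) := OneForm {
  form_at : forall p : M, {scalar tangent p};
  form_smooth : forall X : vfield M, smooth_fun (fun p => form_at p (X p)) }.

Record riemannian_metric (R : realType) (m : nat) (M : manifold R m) :=
  RiemannianMetric {
    metric_at : forall p : M, tangent p -> tangent p -> R;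
    metric_linear : forall (p : M) (a : R) (u v w : tangent p),
      metric_at (a *: u + v) w = a * metric_at u w + metric_at v w;
    metric_sym : forall (p : M) (u v : tangent p),
      metric_at u v = metric_at v u;
    metric_pos : forall (p : M) (v : tangent p), v != 0 -> 0 < metric_at v v;
    metric_smooth : forall X Y : vfield M,
      smooth_fun (fun p => metric_at (X p) (Y p)) }.

Section Action.
Variables (R : realType) (m : nat) (M : manifold R m).

Definition endo_app (phi : endo_field M) (X : vfield M) : vfield M :=
  VField (@endo_smooth _ _ _ phi X).

Definition form_app (eta : one_form M) (X : vfield M) : Cinf M :=
  MkCinf (introT (asboolP _) (@form_smooth _ _ _ eta X)).

Definition metric_app (g : riemannian_metric M) (X Y : vfield M) : Cinf M :=
  MkCinf (introT (asboolP _) (@metric_smooth _ _ _ g X Y)).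

End Action.

Coercion endo_app : endo_field >-> Funclass.
Coercion form_app : one_form >-> Funclass.
Coercion metric_app : riemannian_metric >-> Funclass.

Record affine_connection (R : realType) (m : nat) (M : manifold R m) :=
  AffineConnection {
    conn :> vfield M -> vfield M -> vfield M;
    conn_linear : forall (f : Cinf M) (X Y Z : vfield M),
      conn (f *: X + Y) Z = f *: conn X Z + conn Y Z;
    conn_add : forall X Y Z : vfield M,
      conn X (Y + Z) = conn X Y + conn X Z;
    conn_leibniz : forall (X : vfield M) (f : Cinf M) (Y : vfield M),
      conn X (f *: Y) = vf_app X f *: Y + f *: conn X Y }.

(* torsion-free and metric; there is exactly one such connection *)
Definition levi_civita (R : realType) (m : nat) (M : manifold R m)
    (g : riemannian_metric M) (nabla : affine_connection M) : Prop :=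
  (forall X Y : vfield M, nabla X Y - nabla Y X = lie X Y) /\
  (forall X Y Z : vfield M,
     vf_app X (g Y Z) = g (nabla X Y) Z + g Y (nabla X Z)).

(* (nabla_X phi) Y *)
Definition conn_endo (R : realType) (m : nat) (M : manifold R m)
    (nabla : affine_connection M) (phi : endo_field M) (X Y : vfield M) :
  vfield M := nabla X (phi Y) - phi (nabla X Y).

Record almost_contact_metric (R : realType) (n : nat)
    (M : manifold R (n.*2.+1)) := AlmostContactMetric {
  acm_phi : endo_field M;
  acm_xi : vfield M;
  acm_eta : one_form M;
  acm_g : riemannian_metric M;
  acm_phi2 : forall X : vfield M,
    acm_phi (acm_phi X) = - X + acm_eta X *: acm_xi;
  acm_eta_xi : acm_eta acm_xi = 1;
  acm_compat : forall X Y : vfield M,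
    acm_g (acm_phi X) (acm_phi Y) = acm_g X Y - acm_eta X * acm_eta Y }.

Definition nijenhuis (R : realType) (m : nat) (M : manifold R m)
    (phi : endo_field M) (X Y : vfield M) : vfield M :=
  phi (phi (lie X Y)) + lie (phi X) (phi Y)
  - phi (lie (phi X) Y) - phi (lie X (phi Y)).

(* with the factor 1/2 *)
Definition ext_deriv (R : realType) (m : nat) (M : manifold R m)
    (eta : one_form M) (X Y : vfield M) : Cinf M :=
  2^-1 *: (vf_app X (eta Y) - vf_app Y (eta X) - eta (lie X Y)).

Section Classes.
Variables (R : realType) (n : nat) (M : manifold R (n.*2.+1)).
Variable S : almost_contact_metric M.
Let phi := acm_phi S.
Let xi := acm_xi S.
Let eta := acm_eta S.
Let g := acm_g S.

Definition normal : Prop := forall X Y : vfield M,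
  nijenhuis phi X Y + (2 * ext_deriv eta X Y) *: xi = 0.

(* in the next two definitions, [nabla] is to be the Levi-Civita connection of
   the metric of [S] *)
Definition nearly_kenmotsu (nabla : affine_connection M) : Prop :=
  forall X Y : vfield M,
    conn_endo nabla phi X Y + conn_endo nabla phi Y X =
    - (eta Y *: phi X) - eta X *: phi Y.

Definition kenmotsu (nabla : affine_connection M) : Prop :=
  forall X Y : vfield M,
    conn_endo nabla phi X Y = g (phi X) Y *: xi - eta Y *: phi X.

End Classes.

(* Main.v *)
(** Let [T(X,Y,Z)] be the amount by which [g ((nabla_X phi) Y, Z)] differs from
    its Kenmotsu value. The nearly Kenmotsu condition and the skewness of
    [nabla_X phi] make [T] totally skew. Differentiating
    [phi^2 = - Id + eta (x) xi] gives
    [T(X, phi Y, Z) - T(X, Y, phi Z)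
     = - T(X, xi, phi Y) eta Z - eta Y T(X, xi, phi Z)].
    Normality with [Z = xi] then yields [4 T(X, xi, phi Y) = 0], hence
    [T(X, xi, Z) = 0]; with this, normality for general [Z] reads
    [4 T(X, Y, phi Z) = 0], hence [T = 0]. *)

Require Import Defs.
From mathcomp Require Import all_boot all_order all_algebra.
From mathcomp Require Import all_classical all_reals all_analysis.
From mathcomp Require Import ring.

Set Implicit Arguments.
Unset Strict Implicit.
Unset Printing Implicit Defensive.

Import Order.TTheory GRing.Theory Num.Theory.
Local Open Scope ring_scope.

(** A known equation [a = b] settles the goal [c = d] once both have the same difference of sides;
    what remains is an identity for [ring]. *)
Lemma subr_transfer (V : zmodType) (a b c d : V) :
  a = b -> c - d = a - b -> c = d.
Proof. by move=> ->; rewrite subrr => /eqP; rewrite subr_eq0 => /eqP. Qed.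

(** * Linearity of the operations on tensor fields *)

Section TensorFields.
Variables (R : realType) (m : nat) (M : manifold R m).
Implicit Types (X Y Z : vfield M) (f h : Cinf M).

Lemma vfield_eq X Y : (forall p, X p = Y p) -> X = Y.
Proof. by move=> XY; apply: vfieldP => p f; rewrite XY. Qed.

Lemma CinfP f h : (forall p, f p = h p) -> f = h.
Proof. by move=> fh; apply/val_inj/funext. Qed.

(** Division by [k] goes through the scalar action of the field [R]. *)
Lemma Cinf_mulrn_eq0 f k : (0 < k)%N -> f *+ k = 0 -> f = 0.
Proof.
move=> k0 fk0; rewrite -[f]scale1r -(mulVf (x := k%:R : R)) ?pnatr_eq0 -?lt0n //.
by rewrite -scalerA scaler_nat fk0 scaler0.
Qed.

Lemma vf_appD X f h : vf_app X (f + h) = vf_app X f + vf_app X h.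
Proof. by rewrite -[f]scale1r vf_app_linear !scale1r. Qed.

Lemma vf_app0 X : vf_app X 0 = 0.
Proof. by apply: (addrI (vf_app X 0)); rewrite -vf_appD !addr0. Qed.

Lemma vf_appN X f : vf_app X (- f) = - vf_app X f.
Proof. by apply/eqP; rewrite -addr_eq0 -vf_appD addNr vf_app0. Qed.

Lemma vf_app1 X : vf_app X 1 = 0.
Proof.
have := vf_app_leibniz X 1 1; rewrite !mulr1 mul1r => /eqP.
by rewrite -subr_eq0 opprD addrA subrr sub0r oppr_eq0 => /eqP.
Qed.

Lemma endo_appD (phi : endo_field M) X Y : phi (X + Y) = phi X + phi Y.
Proof. by apply: vfield_eq => p; exact: linearD. Qed.

Lemma endo_appZ (phi : endo_field M) f X : phi (f *: X) = f *: phi X.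
Proof. by apply: vfield_eq => p; exact: linearZ. Qed.

Lemma endo_appN (phi : endo_field M) X : phi (- X) = - phi X.
Proof. by rewrite -scaleN1r endo_appZ scaleN1r. Qed.

Lemma endo_app0 (phi : endo_field M) : phi 0 = 0.
Proof. by apply: (addrI (phi 0)); rewrite -endo_appD !addr0. Qed.

Lemma form_appZ (eta : one_form M) f X : eta (f *: X) = f * eta X.
Proof. by apply: CinfP => p; exact: linearZ. Qed.

Lemma metric_appC (g : riemannian_metric M) X Y : g X Y = g Y X.
Proof. by apply: CinfP => p; exact: (Defs.metric_sym g (X p) (Y p)). Qed.

Lemma metric_appDl (g : riemannian_metric M) X Y Z :
  g (X + Y) Z = g X Z + g Y Z.
Proof.
apply: CinfP => p; have := metric_linear g 1 (X p) (Y p) (Z p).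
by rewrite scale1r mul1r.
Qed.

Lemma metric_app0l (g : riemannian_metric M) Z : g 0 Z = 0.
Proof. by apply: (addrI (g 0 Z)); rewrite -metric_appDl !addr0. Qed.

Lemma metric_appZl (g : riemannian_metric M) f X Z : g (f *: X) Z = f * g X Z.
Proof.
apply: CinfP => p; have := metric_linear g (f p) (X p) 0 (Z p).
have := congr1 (fun h : Cinf M => h p) (metric_app0l g Z).
by rewrite /= addr0 => ->; rewrite [X in _ + X]/= addr0.
Qed.

Lemma metric_appNl (g : riemannian_metric M) X Z : g (- X) Z = - g X Z.
Proof. by rewrite -scaleN1r metric_appZl mulN1r. Qed.

Lemma metric_appDr (g : riemannian_metric M) X Y Z :
  g X (Y + Z) = g X Y + g X Z.
Proof. by rewrite !(metric_appC g X) metric_appDl. Qed.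

Lemma metric_appZr (g : riemannian_metric M) f X Z : g X (f *: Z) = f * g X Z.
Proof. by rewrite !(metric_appC g X) metric_appZl. Qed.

Lemma metric_appNr (g : riemannian_metric M) X Z : g X (- Z) = - g X Z.
Proof. by rewrite !(metric_appC g X) metric_appNl. Qed.

Lemma metric_app0r (g : riemannian_metric M) X : g X 0 = 0.
Proof. by rewrite metric_appC metric_app0l. Qed.

Definition metric_appE :=
  (metric_appDl, metric_appDr, metric_appNl, metric_appNr,
   metric_appZl, metric_appZr, metric_app0l, metric_app0r).

Lemma metric_app_eq0 (g : riemannian_metric M) X : g X X = 0 -> X = 0.
Proof.
move=> gX0; apply: vfieldP => p f.
suff -> : X p = 0 by [].
apply/eqP; apply: contraT => /(metric_pos g).
have := congr1 (fun h : Cinf M => h p) gX0.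
by rewrite /= => ->; rewrite ltxx.
Qed.

Lemma connN (nabla : affine_connection M) X Y : nabla X (- Y) = - nabla X Y.
Proof.
rewrite -scaleN1r conn_leibniz vf_appN vf_app1 oppr0 scale0r add0r.
by rewrite scaleN1r.
Qed.

Lemma conn0 (nabla : affine_connection M) X : nabla X 0 = 0.
Proof. by apply: (addrI (nabla X 0)); rewrite -conn_add !addr0. Qed.

End TensorFields.


(** * Algebraic identities of an almost contact metric structure *)

Section AlmostContactMetric.
Variables (R : realType) (n : nat) (M : manifold R (n.*2.+1)).
Variable S : almost_contact_metric M.
Implicit Types X Y Z : vfield M.
Local Notation phi := (acm_phi S).
Local Notation xi := (acm_xi S).
Local Notation eta := (acm_eta S).
Local Notation g := (acm_g S).

(** Since [phi (phi xi) = 0], the formula for [phi^2] at [phi xi] gives [phi xi = f *: xi] with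
    [f = eta (phi xi)]. Then [g (phi xi) (phi xi) = g (phi (f *: xi)) xi = g (phi (phi xi)) xi =
    0]. *)
Lemma acm_phi_xi : phi xi = 0.
Proof.
have phi2 : phi (phi xi) = 0 by rewrite acm_phi2 acm_eta_xi scale1r addNr.
have phiE : phi xi = eta (phi xi) *: xi.
  have := acm_phi2 S (phi xi); rewrite phi2 endo_app0 => /esym/eqP.
  by rewrite addrC subr_eq0 => /eqP.
apply: (metric_app_eq0 (g := g)).
by rewrite {2}phiE metric_appZr -metric_appZl -endo_appZ -phiE phi2 metric_app0l.
Qed.

Lemma acm_etaE X : eta X = g X xi.
Proof.
have := acm_compat S X xi; rewrite acm_phi_xi metric_app0r acm_eta_xi mulr1.
by move/esym/eqP; rewrite subr_eq0 => /eqP.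
Qed.

(** Computing [phi^3 X] as [phi (phi^2 X)] and as [phi^2 (phi X)] leaves [eta (phi X) *: xi = 0], to
    which [eta] is applied. *)
Lemma acm_eta_phi X : eta (phi X) = 0.
Proof.
have h : phi (phi (phi X)) = - phi X.
  by rewrite [X in phi X]acm_phi2 endo_appD endo_appN endo_appZ acm_phi_xi
             scaler0 addr0.
move: h; rewrite acm_phi2 -[RHS]addr0 => /addrI h.
by rewrite -[LHS]mulr1 -(acm_eta_xi S) -form_appZ h -(scale0r xi) form_appZ mul0r.
Qed.

Lemma acm_g_phi X Y : g (phi X) Y = - g X (phi Y).
Proof.
have := acm_compat S X (phi Y); rewrite acm_eta_phi mulr0 subr0 acm_phi2.
by rewrite !metric_appE -acm_etaE acm_eta_phi mulr0 addr0 => <-; rewrite opprK.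
Qed.

(** * Covariant derivatives of [phi] and [xi] *)

Section LeviCivita.
Variable nabla : affine_connection M.
Hypothesis hnabla : levi_civita g nabla.
Local Notation F := (conn_endo nabla phi).

Lemma conn_torsion X Y : nabla X Y - nabla Y X = lie X Y.
Proof. by case: hnabla. Qed.

Lemma conn_metric X Y Z :
  vf_app X (g Y Z) = g (nabla X Y) Z + g Y (nabla X Z).
Proof. by case: hnabla. Qed.

(** Obtained by differentiating the skewness of [phi] along [X]. *)
Lemma conn_endo_skew X Y Z : g (F X Y) Z = - g Y (F X Z).
Proof.
have : vf_app X (g (phi Y) Z) = - vf_app X (g Y (phi Z)).
  by rewrite acm_g_phi vf_appN.
rewrite !conn_metric /conn_endo !metric_appE !acm_g_phi => h.
apply: (subr_transfer h); ring.
Qed.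

Lemma eta_conn_xi X : eta (nabla X xi) = 0.
Proof.
have : vf_app X (g xi xi) = 0 by rewrite -acm_etaE acm_eta_xi vf_app1.
rewrite conn_metric [g xi _]metric_appC -mulr2n acm_etaE.
exact: Cinf_mulrn_eq0.
Qed.

Lemma conn_endo_xi X : F X xi = - phi (nabla X xi).
Proof. by rewrite /conn_endo acm_phi_xi conn0 sub0r. Qed.

(** Eliminates [nabla X xi] in favour of [F], so that later identities can be written in [defect]
    alone. *)
Lemma metric_conn_xi X Z : g (nabla X xi) Z = - g (F X xi) (phi Z).
Proof.
by rewrite conn_endo_xi metric_appE opprK acm_compat eta_conn_xi mul0r subr0.
Qed.

(** The covariant derivative of the formula for [phi^2], paired with [Z]. *)
Lemma conn_endo_phi X Y Z : g (F X (phi Y)) Z - g (F X Y) (phi Z) =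
  g (nabla X xi) Y * eta Z + eta Y * g (nabla X xi) Z.
Proof.
rewrite /conn_endo acm_phi2 conn_add connN conn_leibniz !metric_appE acm_compat.
rewrite acm_g_phi (acm_etaE Y) conn_metric -!acm_etaE -[g xi Z]metric_appC.
rewrite -(metric_appC g Z) -acm_etaE (metric_appC g Y).
ring.
Qed.

(** Vanishing torsion turns every Lie bracket into covariant derivatives; the derivatives of
    arguments cancel and only those of [phi] and [xi] survive. *)
Lemma normalE X Y Z : normal S ->
  g (F (phi X) Y) Z - g (F (phi Y) X) Z - g (F Y X) (phi Z) + g (F X Y) (phi Z)
  + (g (nabla X xi) Y - g (nabla Y xi) X) * eta Z = 0.
Proof.
move=> hN; have h := congr1 (fun V => g V Z) (hN X Y).
have extE : 2 * ext_deriv eta X Y = g (nabla X xi) Y - g (nabla Y xi) X.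
  rewrite /ext_deriv mulr_natl -scaler_nat scalerA mulfV ?pnatr_eq0 // scale1r.
  rewrite -conn_torsion !acm_etaE !conn_metric !metric_appE.
  rewrite (metric_appC g Y (nabla _ _)) (metric_appC g X (nabla _ _)); ring.
move: h; rewrite extE /nijenhuis -!conn_torsion /conn_endo.
rewrite !(endo_appD, endo_appN) !acm_phi2 !metric_appE.
rewrite !(acm_g_phi (nabla _ _)) => h.
apply: (subr_transfer h).
rewrite (acm_phi2 S Z) !metric_appE (metric_appC g xi) -!acm_etaE; ring.
Qed.

(** The tensor [T] of the overview. *)
Definition defect X Y Z :=
  g (F X Y) Z - g (phi X) Y * eta Z + eta Y * g (phi X) Z.

(** * Symmetries and vanishing of the defect *)

Section NearlyKenmotsu.
Hypothesis hNK : nearly_kenmotsu S nabla.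

Lemma defect_skew12 X Y Z : defect X Y Z = - defect Y X Z.
Proof.
have h := congr1 (fun V => g V Z) (hNK X Y).
move: h; rewrite /defect !metric_appE => h.
apply: (subr_transfer h).
rewrite (acm_g_phi X Y) (metric_appC g X); ring.
Qed.

Lemma defect_skew23 X Y Z : defect X Y Z = - defect X Z Y.
Proof. rewrite /defect conn_endo_skew (metric_appC g Y); ring. Qed.

Lemma defectDr X Y Z W : defect X Y (Z + W) = defect X Y Z + defect X Y W.
Proof. by rewrite /defect !acm_etaE !metric_appE; ring. Qed.

Lemma defectZr X Y f Z : defect X Y (f *: Z) = f * defect X Y Z.
Proof. by rewrite /defect !acm_etaE !metric_appE; ring. Qed.

Lemma defect_diag X Z : defect X X Z = 0.
Proof.
apply: (@Cinf_mulrn_eq0 _ _ _ _ 2) => //.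
by rewrite mulr2n {1}defect_skew12 addNr.
Qed.

Lemma defect_phi X Y Z : defect X (phi Y) Z - defect X Y (phi Z) =
  - defect X xi (phi Y) * eta Z - eta Y * defect X xi (phi Z).
Proof.
(* The Kenmotsu value satisfies the same identity, so its terms cancel. *)
have h := conn_endo_phi X Y Z; apply: (subr_transfer h).
rewrite !metric_conn_xi /defect !acm_eta_phi acm_eta_xi !(acm_g_phi X).
rewrite acm_phi_xi !metric_appE.
ring.
Qed.

Hypothesis hN : normal S.

Lemma defect_normal X Y Z :
  defect (phi X) Y Z + defect X (phi Y) Z + 2 * defect X Y (phi Z)
  = (defect X xi (phi Y) - defect Y xi (phi X)) * eta Z.
Proof.
have FE A B C : g (F A B) C =
  defect A B C + g (phi A) B * eta C - eta B * g (phi A) C.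
  by rewrite /defect; ring.
have := normalE X Y Z hN; rewrite !metric_conn_xi !FE.
rewrite (defect_skew12 (phi Y)) (defect_skew12 Y X) => h.
apply: (subr_transfer h).
rewrite !acm_compat acm_eta_xi !acm_eta_phi !acm_phi2 !metric_appE.
rewrite !(metric_appC g xi) -!acm_etaE !acm_eta_phi (metric_appC g Y X); ring.
Qed.

(** By the formula for [phi^2], each [Z] is the sum of a [phi]-image and a multiple of [xi]. *)
Lemma defect_phi_descend X Y :
  (forall Z, defect X Y (phi Z) = 0) -> defect X Y xi = 0 ->
  forall Z, defect X Y Z = 0.
Proof.
move=> h hxi Z; have := h (phi Z).
rewrite acm_phi2 defectDr defectZr hxi mulr0 addr0 -scaleN1r defectZr mulN1r.
by move/eqP; rewrite oppr_eq0 => /eqP.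
Qed.

Lemma defect_xi X Z : defect X xi Z = 0.
Proof.
(* With [xi] in the first slot, the right side of [defect_phi] vanishes, so [phi] moves freely
   between the other two slots. *)
have skew A B : defect A xi (phi B) = - defect B xi (phi A).
  have := defect_phi xi A B; rewrite !defect_diag oppr0 mul0r mulr0 subr0.
  move/eqP; rewrite subr_eq0 => /eqP h.
  by rewrite defect_skew12 -h defect_skew23 opprK defect_skew12.
apply: defect_phi_descend => [{}Z|]; last first.
  apply: (@Cinf_mulrn_eq0 _ _ _ _ 2) => //.
  by rewrite mulr2n {1}defect_skew23 addNr.
apply: (@Cinf_mulrn_eq0 _ _ _ _ 4) => //.
have h := defect_normal X Z xi; symmetry; apply: (subr_transfer h).
rewrite acm_phi_xi acm_eta_xi (defect_skew12 (phi X)) !(defect_skew23 _ (phi _)).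
(* The zero field [phi xi] is written [0 *: 0] so that linearity in the last slot kills its term. *)
rewrite -(scale0r (0 : vfield M)) defectZr (skew Z X); ring.
Qed.

Lemma defect0 X Y Z : defect X Y Z = 0.
Proof.
apply: defect_phi_descend => [{}Z|]; last by rewrite defect_skew23 defect_xi oppr0.
have hphi A B : defect A (phi B) Z = defect A B (phi Z).
  apply: (subr_transfer (defect_phi A B Z)); rewrite !defect_xi; ring.
apply: (@Cinf_mulrn_eq0 _ _ _ _ 4) => //.
apply: (subr_transfer (defect_normal X Y Z)).
(* Moving [phi] to the last slot makes the left side of [defect_normal] four equal terms, and its
   right side is zero. *)
rewrite (defect_skew12 (phi X)) !hphi (defect_skew12 Y) !defect_xi; ring.
Qed.

End NearlyKenmotsu.
End LeviCivita.
End AlmostContactMetric.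

Theorem theorem3 (R : realType) (n : nat) (M : manifold R (n.*2.+1))
    (S : almost_contact_metric M) (nabla : affine_connection M)
    (hnabla : levi_civita (acm_g S) nabla)
    (hnormal : normal S) (hnk : nearly_kenmotsu S nabla) :
  kenmotsu S nabla.
Proof.
move=> X Y; apply/eqP; rewrite -subr_eq0; apply/eqP.
(* [D] is the difference of the two sides, and [g D D] is exactly [defect X Y D]. *)
apply: (metric_app_eq0 (g := acm_g S)); set D := (X in metric_app _ X X).
have := defect0 hnabla hnk hnormal X Y D; rewrite /defect => hD.
apply: (subr_transfer hD); rewrite {1}/D; move: D {hD} => D.
rewrite /conn_endo !metric_appE (metric_appC _ (acm_xi S)) -acm_etaE; ring.
Qed.
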